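(* Let $n\geq 1$ and let $a_1,\ldots,a_n$ be a monotonic (increasing or decreasing) sequence of $n$ distinct real numbers. Then there is a permutation $b_1,\ldots,b_n$ of $a_1,\ldots,a_n$ with $b_1=a_1$ such that the $n-1$ numbers $$|b_1-b_2|,\ |b_2-b_3|,\ \ldots,\ |b_{n-1}-b_n|$$ are pairwise distinct. *)

(* Defs.v *)
From mathcomp Require Export all_boot all_order all_algebra.
From mathcomp Require Export reals.

(* Main.v *)
Require Import Defs.
From mathcomp Require Import all_boot all_order all_algebra.
From mathcomp Require Import reals.
Import Order.TTheory GRing.Theory Num.Theory.
Local Open Scope ring_scope.

(** The zigzag a_1, a_n, a_2, a_(n-1), ... works: the intervals spanned by
    consecutive terms are strictly nested, so the gaps strictly decrease.
    Recursively, the zigzag of x :: s is x followed by the zigzag of rev s,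
    whose monotonicity is opposite to that of s. *)

Lemma ltr_dist_between (R : realDomainType) (x y z : R) :
  (x < z < y) || (y < z < x) -> `|y - z| < `|x - y|.
Proof.
case/orP=> /andP[h1 h2]; have h3 := lt_trans h1 h2.
  by rewrite [ltRHS]distrC !gtr0_norm ?subr_gt0 // ltrD2l ltrN2.
by rewrite distrC !gtr0_norm ?subr_gt0 // ltrD2r.
Qed.

(** Strict decrease of the gaps, stronger than distinctness, suits the induction: prepending a term
    requires only that the new gap exceed the first old one. *)
Lemma strict_monotone_zigzag (R : realDomainType) (x : R) (s : seq R) :
    path <%R x s \/ path >%R x s ->
  exists2 t, perm_eq t s &
    sorted >%R [seq `|(x :: t)`_i - (x :: t)`_i.+1| | i <- iota 0 (size t)].
Proof.
(* The induction is on a size bound, since the recursive call is on a reversed list rather than a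
   sublist. *)
have [n] := ubnP (size s); elim: n x s => // n IHn x s.
case/lastP: s => [|s y]; first by exists [::].
rewrite size_rcons ltnS => size_s x_mono.
have [y_mono between] : (path <%R y (rev s) \/ path >%R y (rev s)) /\
    {in s, forall z, (x < z < y) || (y < z < x)}.
  have mem_s z : z \in s -> z \in rcons s y /\ z \in rev s.
    by rewrite mem_rcons mem_rev inE => ->; rewrite orbT.
  case: x_mono => x_mono.
    have y_mono : path >%R y (rev s).
      by have := path_sorted x_mono; rewrite -(rev_sorted >%R) rev_rcons.
    split=> [|z /mem_s[zx zy]]; first by right.
    have /allP/(_ z zx)/= -> := order_path_min lt_trans x_mono.
    by have /allP/(_ z zy)/= -> := order_path_min (rev_trans lt_trans) y_mono.
  have y_mono : path <%R y (rev s).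
    by have := path_sorted x_mono; rewrite -(rev_sorted <%R) rev_rcons.
  split=> [|z /mem_s[zx zy]]; first by left.
  have /allP/(_ z zx)/= -> := order_path_min (rev_trans lt_trans) x_mono.
  by have /allP/(_ z zy)/= -> := order_path_min lt_trans y_mono; rewrite orbT.
have [|t tP t_sorted] := IHn y (rev s) _ y_mono; first by rewrite size_rev.
exists (y :: t).
  by rewrite perm_sym perm_rcons perm_cons -perm_rev perm_sym.
(* With [t] empty there is a single gap. Otherwise the term [z] after [y] comes from [s], hence lies
   strictly between [x] and [y]. *)
case: t tP t_sorted => [//|z t] tP t_sorted.
have zs : z \in s by rewrite -mem_rev -(perm_mem tP) mem_head.
(* Index 0 is split off and the others shifted down by one, turning the remaining gaps into those of
   [y :: z :: t]. *)
rewrite [size (y :: _)]/= -add1n iotaD map_cat (iotaDl 1 0) -map_comp.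
by rewrite /= ltr_dist_between ?between.
Qed.

Theorem theorem1p1 (R : realType) (n : nat) (hn : (1 <= n)%N)
    (a : n.-tuple R) (a_distinct : uniq a)
    (a_monotonic : sorted <=%R a \/ sorted >=%R a) :
  exists b : n.-tuple R,
    [/\ perm_eq b a,
        b`_0 = a`_0 &
        uniq [seq `|b`_i - b`_i.+1| | i <- iota 0 n.-1]].
Proof.
case: a a_distinct a_monotonic => -[|x s] /= size_a a_uniq a_mono.
  by move: size_a hn => /eqP <-.
have mono : path <%R x s \/ path >%R x s.
  case: a_mono => mono; [left | right].
    by rewrite -[path _ _ _]/(sorted _ (_ :: _)) lt_sorted_uniq_le /= a_uniq.
  (* The decreasing case is reduced to the increasing one by reversal. *)
  rewrite -[path _ _ _]/(sorted _ (_ :: _)) -(rev_sorted <%R).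
  by rewrite lt_sorted_uniq_le rev_uniq rev_sorted /= a_uniq.
have [t ts t_sorted] := strict_monotone_zigzag _ _ _ mono.
have size_b : size (x :: t) == n by rewrite /= (perm_size ts).
exists (Tuple size_b); split=> //=; first by rewrite perm_cons.
rewrite -(eqP size_b).
(* A list sorted for a transitive irreflexive relation has no repetition. *)
by apply: sorted_uniq t_sorted; [exact: rev_trans lt_trans | exact: ltxx].
Qed.
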